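(* Let $\{\alpha,\beta\}=\{1,2\}$ and let $\mathcal C$ be a 2D convolutional code with generator matrix $G(z_1,z_2)=\sum_{l=0}^{\mu_\alpha}G^{(\beta)}_l(z_\beta)z_\alpha^l\in\mathbb F[z_1,z_2]^{n\times k}$ such that $G_0^{(\beta)}(z_\beta)$ has full column rank and $k<n$, and assume $\mu_\alpha>e_\beta$, where $e_\beta$ is the largest integer $e\ge 0$ such that $k(e+1)<n$ and $[G^{(\beta)}_{e}(z_\beta),\dots,G^{(\beta)}_0(z_\beta)]$ has full column rank. Let $v=Gu=\sum_{i=0}^{\mu_\alpha+m_\alpha}v_i^{(\beta)}(z_\beta)z_\alpha^i$ be the sent codeword, and let $\hat v$ be the received word with erasures. Suppose that the erasure pattern is such that there are indices $0\le j_0<j_1<\cdots<j_l=\mu_\alpha+m_\alpha$ with $j_0\le e_\beta$ and $j_r-(j_{r-1}+1)\le e_\beta$ for $r=1,\dots,l$, such that the erasure pattern of $\hat v^{(\beta)}_{j_0}(z_\beta)$ can be decoded in the code generated by $[G^{(\beta)}_{j_0},\dots,G^{(\beta)}_0](z_\beta)$ and, for $r=1,\dots,l$, the erasure pattern of $\hat v^{(\beta)}_{j_r}(z_\beta)$ can be decoded in the code generated by $[G^{(\beta)}_{j_r-(j_{r-1}+1)},\dots,G^{(\beta)}_0](z_\beta)$. Then Algorithm 2.1 recovers all erasures, i.e. it determines $u$ and $v$ completely.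
   Context: $\mathbb F$ is a finite field. A 2D $(n,k)$ convolutional code is a free $\mathbb F[z_1,z_2]$-submodule $\mathcal C=\{G(z_1,z_2)u : u\in\mathbb F[z_1,z_2]^k\}$ of $\mathbb F[z_1,z_2]^n$ of rank $k$. $\mu_\alpha=\deg_{z_\alpha}G$, $m_\alpha$ is the degree of the message $u=\sum_{i=0}^{m_\alpha}u_i^{(\beta)}(z_\beta)z_\alpha^i$ in $z_\alpha$, $d_\alpha=\mu_\alpha+m_\alpha$ (and similarly $d_\beta$). With $u_i^{(\beta)}=0$ for $i>m_\alpha$ and $G^{(\beta)}_l=0$ for $l>\mu_\alpha$ one has $v_i^{(\beta)}(z_\beta)=\sum_{l+m=i}G_l^{(\beta)}(z_\beta)u_m^{(\beta)}(z_\beta)$. The received word is $\hat v=\sum_{i\le d_\alpha}\hat v_i^{(\beta)}(z_\beta)z_\alpha^i$; each component of each coefficient vector of $v_i^{(\beta)}(z_\beta)$ either arrives correctly or is erased, with known erasure positions. The receiver knows $d_\alpha,d_\beta$ but not $m_\alpha$ separately. 1D codes. For a full column rank $M(z)\in\mathbb F[z]^{n\times\kappa}$, $\kappa<n$, let $\mathcal D=\{M(z)w:w\in\mathbb F[z]^\kappa\}$ and let $\tilde{\mathcal D}$ be the smallest noncatastrophic code containing $\mathcal D$, i.e. $\tilde{\mathcal D}=\operatorname{Im}\tilde M(z)$ where $M=\tilde MX$ with $\tilde M\in\mathbb F[z]^{n\times\kappa}$ right prime (meaning $\tilde M=\bar MY$ with $\bar M\in\mathbb F[z]^{n\times\kappa}$,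 $Y\in\mathbb F[z]^{\kappa\times\kappa}$ forces $Y$ unimodular) and $X\in\mathbb F[z]^{\kappa\times\kappa}$ nonsingular; $\tilde{\mathcal D}$ is the kernel of a left prime $H(z)\in\mathbb F[z]^{(n-\kappa)\times n}$. Column distances: $d_j^c(\tilde{\mathcal D})=\min\{\sum_{t=0}^j wt(w_t): \sum_t w_tz^t\in\tilde{\mathcal D},\ w_0\neq0\}$ with $wt$ the Hamming weight. Let $\hat w(z)=\sum_{i=0}^{s}\hat w_iz^i$ be a word of $\mathcal D$ with erasures, $\epsilon_i$ the number of erased components of $\hat w_i$ ($\epsilon_i=0$ for $i>s$). Its erasure pattern ''can be decoded (recovered) in the code generated by $M(z)$'' if for every $0\le i\le s$ there is $j\ge0$ with $\epsilon_i+\cdots+\epsilon_{i+j}\le d_j^c(\tilde{\mathcal D})-1$; in this case the erasures are recovered successively for $i=0,1,\dots,s$ by solving the linear equations coming from $H(z)w(z)=0$ (this procedure is ''Algorithm 1''). Algorithm 2.1. Start with $b=0$. At stage $b$, with $S=\sum_{t<b}x_t$ (so $u_0^{(\beta)},\dots,u_{S-1}^{(\beta)}$ are already known), try $x_b=e_\beta+1,e_\beta,\dots,1$ in this order (only values with $S+x_b-1\le d_\alpha$ are considered): if the erasure pattern of $\hat v^{(\beta)}_{S+x_b-1}(z_\beta)$ can be decoded in the code generated by $[G^{(\beta)}_{x_b-1}(z_\beta),\dots,G^{(\beta)}_0(z_\beta)]$, apply Algorithm 1 in this code to $\hat v^{(\beta)}_{S+x_b-1}-\sum_{l+m=S+x_b-1,\,m<S}G_l^{(\beta)}u_m^{(\beta)}$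 (which has the same erasure pattern) to recover $v^{(\beta)}_{S+x_b-1}$, obtain $u_S^{(\beta)},\dots,u_{S+x_b-1}^{(\beta)}$ by injectivity of $[G^{(\beta)}_{x_b-1},\dots,G^{(\beta)}_0]$, and go to stage $b+1$. If no $x_b\ge1$ works, stop: if $\sum_{t<b}x_t-1=d_\alpha$ the algorithm ends with successful recovery of everything, otherwise it ends without full recovery. *)

(* Defs.v *)
From HB Require Import structures.
From mathcomp Require Import all_boot all_order all_algebra.
From mathcomp Require Export mpoly.

Set Implicit Arguments.
Unset Strict Implicit.
Unset Printing Implicit Defensive.

Import GRing.Theory.
Local Open Scope ring_scope.

Definition full_col_rank (R : idomainType) (n k : nat) (M : 'M[R]_(n, k)) :=
  \rank (map_mx (@FracField.tofrac R) M) = k.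

(** * One-dimensional codes *)

(* Over F[z], [unitmx] is the set of unimodular matrices. *)
Definition right_prime (F : fieldType) (n k : nat) (M : 'M[{poly F}]_(n, k)) :=
  forall (Mbar : 'M[{poly F}]_(n, k)) (Y : 'M[{poly F}]_k),
    M = Mbar *m Y -> Y \in unitmx.

Definition left_prime (F : fieldType) (m n : nat) (H : 'M[{poly F}]_(m, n)) :=
  forall (Y : 'M[{poly F}]_m) (Hbar : 'M[{poly F}]_(m, n)),
    H = Y *m Hbar -> Y \in unitmx.

(* The smallest noncatastrophic code containing the image of M. The image of
   Mt does not depend on the factorization when M has full column rank. *)
Definition nc_closure (F : fieldType) (n k : nat) (M : 'M[{poly F}]_(n, k))
    (w : 'cV[{poly F}]_n) : Prop :=
  exists (Mt : 'M[{poly F}]_(n, k)) (X : 'M[{poly F}]_k),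
    [/\ right_prime Mt, \det X != 0, M = Mt *m X
      & exists x : 'cV[{poly F}]_k, w = Mt *m x].

Definition parity_check (F : fieldType) (n k : nat) (M : 'M[{poly F}]_(n, k))
    (H : 'M[{poly F}]_(n - k, n)) : Prop :=
  left_prime H /\ forall w : 'cV[{poly F}]_n, nc_closure M w <-> H *m w = 0.

Definition coef_cv (F : fieldType) (n : nat) (w : 'cV[{poly F}]_n) (t : nat) :
    'cV[F]_n := \col_c (w c 0)`_t.

Definition hamming_wt (F : fieldType) (n : nat) (a : 'cV[F]_n) : nat :=
  #|[set c | a c 0 != 0]|.

(* d = d_j^c(D) *)
Definition col_distance (F : fieldType) (n : nat) (D : 'cV[{poly F}]_n -> Prop)
    (j d : nat) : Prop :=
  (exists w, [/\ D w, coef_cv w 0 != 0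
               & (\sum_(t < j.+1) hamming_wt (coef_cv w t))%N = d])
  /\ (forall w, D w -> coef_cv w 0 != 0 ->
        (d <= \sum_(t < j.+1) hamming_wt (coef_cv w t))%N).

(* A received word of degree at most s is read off what t c for t <= s, None
   marking an erasure; its coefficients of degree > s are known to be zero. *)
Definition received_coef (F : fieldType) (n s : nat)
    (what : nat -> 'I_n -> option F) (t : nat) (c : 'I_n) : option F :=
  if (t <= s)%N then what t c else Some 0.

Definition erasures (F : fieldType) (n s : nat)
    (what : nat -> 'I_n -> option F) (t : nat) : nat :=
  #|[set c | received_coef s what t c == None]|.

(* Column distances are positive, so [sum < d] is [sum <= d - 1]. *)
Definition window_decodable (F : fieldType) (n k s : nat)
    (M : 'M[{poly F}]_(n, k)) (what : nat -> 'I_n -> option F)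
    (i j : nat) : Prop :=
  exists2 d, col_distance (nc_closure M) j d
           & (\sum_(i <= t < (i + j).+1) erasures s what t < d)%N.

Definition decodable (F : fieldType) (n k s : nat)
    (M : 'M[{poly F}]_(n, k)) (what : nat -> 'I_n -> option F) : Prop :=
  forall i, (i <= s)%N -> exists j, window_decodable s M what i j.

(* W solves the coefficients i, ..., i + j of H w = 0, the coefficients of w
   below i being those of p and the nonerased ones in the window being as
   received. *)
Definition window_solution (F : fieldType) (m n s : nat)
    (H : 'M[{poly F}]_(m, n)) (what : nat -> 'I_n -> option F) (i j : nat)
    (p W : 'cV[{poly F}]_n) : Prop :=
  [/\ forall t, (t < i)%N -> coef_cv W t = coef_cv p t,
      forall t c a, (i <= t <= i + j)%N -> received_coef s what t c = Some a ->
        coef_cv W t c 0 = a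
    & forall t, (i <= t <= i + j)%N -> coef_cv (H *m W) t = 0].

(* alg1_run M H s what i p: the coefficients 0, ..., i - 1 have been recovered
   successively, and p is the polynomial vector they form. *)
Inductive alg1_run (F : fieldType) (n k : nat) (M : 'M[{poly F}]_(n, k))
    (H : 'M[{poly F}]_(n - k, n)) (s : nat) (what : nat -> 'I_n -> option F) :
    nat -> 'cV[{poly F}]_n -> Prop :=
| Alg1Start : alg1_run M H s what 0 0
| Alg1Step i j p W of (i <= s)%N & alg1_run M H s what i p
    & window_decodable s M what i j & window_solution s H what i j p W :
    alg1_run M H s what i.+1 (p + \col_c ((W c 0)`_i *: 'X^i)).

Definition alg1 (F : fieldType) (n k : nat) (M : 'M[{poly F}]_(n, k))
    (s : nat) (what : nat -> 'I_n -> option F) (w : 'cV[{poly F}]_n) : Prop :=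
  exists2 H, parity_check M H & alg1_run M H s what s.+1 w.

(** * Two-dimensional codes *)

(* The coefficient p_i(z_b) of z_a^i in p(z_1, z_2), for {a, b} = {1, 2}. *)
Definition slice (F : fieldType) (a b : 'I_2) (p : {mpoly F[2]}) (i : nat) :
    {poly F} :=
  \poly_(t < msize p) p@_(U_(a) *+ i + U_(b) *+ t)%MM.

Definition slice_mx (F : fieldType) (a b : 'I_2) (m n : nat)
    (A : 'M[{mpoly F[2]}]_(m, n)) (i : nat) : 'M[{poly F}]_(m, n) :=
  map_mx (fun p => slice a b p i) A.

(* The degree in z_a; the zero matrix has degree 0. *)
Definition deg_in (F : fieldType) (a : 'I_2) (m n : nat)
    (A : 'M[{mpoly F[2]}]_(m, n)) : nat :=
  \max_(i < m) \max_(j < n) \max_(mu <- msupp (A i j)) mu a.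

(* \sum_i (cs_i)(z_b) z_a^i *)
Definition unslice (F : fieldType) (a b : 'I_2) (k : nat)
    (cs : seq 'cV[{poly F}]_k) : 'cV[{mpoly F[2]}]_k :=
  \col_r \sum_(i < size cs)
    (map_poly (@mpolyC 2 F) (cs`_i r 0)).['X_b] * 'X_a ^+ i.

(* [G_e(z_b), ..., G_0(z_b)] *)
Definition gen_block (F : fieldType) (a b : 'I_2) (n k : nat)
    (G : 'M[{mpoly F[2]}]_(n, k)) (e : nat) :
    'M[{poly F}]_(n, \sum_(j < e.+1) k) :=
  \mxrow_(j < e.+1) slice_mx a b G (e - j).

Definition admissible_block (F : fieldType) (a b : 'I_2) (n k : nat)
    (G : 'M[{mpoly F[2]}]_(n, k)) (e : nat) : Prop :=
  (k * e.+1 < n)%N /\ full_col_rank (gen_block a b G e).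

Definition largest_block (F : fieldType) (a b : 'I_2) (n k : nat)
    (G : 'M[{mpoly F[2]}]_(n, k)) (e : nat) : Prop :=
  admissible_block a b G e
  /\ forall e', admissible_block a b G e' -> (e' <= e)%N.

(* vhat i t c is the component c of the coefficient of z_a^i z_b^t, or None if
   it is erased; only i <= da and t <= db are meaningful. *)
Definition received (F : fieldType) (a b : 'I_2) (n da db : nat)
    (v : 'cV[{mpoly F[2]}]_n) (vhat : nat -> nat -> 'I_n -> option F) : Prop :=
  forall i t c, (i <= da)%N -> (t <= db)%N ->
    vhat i t c = None \/ vhat i t c = Some (slice a b (v c 0) i)`_t.

(* vhat_N - \sum_(l + m = N, m < S) G_l u_m, where us = [u_0, ..., u_(S-1)] *)
Definition residual_word (F : fieldType) (a b : 'I_2) (n k : nat)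
    (G : 'M[{mpoly F[2]}]_(n, k)) (vhat : nat -> nat -> 'I_n -> option F)
    (us : seq 'cV[{poly F}]_k) (N : nat) : nat -> 'I_n -> option F :=
  let known := \sum_(m < size us) slice_mx a b G (N - m) *m us`_m in
  fun t c => omap (fun y => y - (known c 0)`_t) (vhat N t c).

(* The test of the value x at the stage where S coefficients of u are known *)
Definition block_works (F : fieldType) (a b : 'I_2) (n k : nat)
    (G : 'M[{mpoly F[2]}]_(n, k)) (e da db : nat)
    (vhat : nat -> nat -> 'I_n -> option F) (S x : nat) : Prop :=
  [/\ (0 < x <= e.+1)%N, ((S + x).-1 <= da)%N
    & decodable db (gen_block a b G x.-1) (vhat (S + x).-1)].

(* alg2 G e da db vhat us r: started with us = [u_0, ..., u_(S-1)] already
   known, the algorithm can end with result r, which is Some (u, v) upon full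
   recovery and None otherwise. The values x are tried from e + 1 downwards, so
   the one selected is the largest that works. *)
Inductive alg2 (F : fieldType) (a b : 'I_2) (n k : nat)
    (G : 'M[{mpoly F[2]}]_(n, k)) (e da db : nat)
    (vhat : nat -> nat -> 'I_n -> option F) :
    seq 'cV[{poly F}]_k ->
    option ('cV[{mpoly F[2]}]_k * 'cV[{mpoly F[2]}]_n) -> Prop :=
| Alg2Step us x w (bl : seq 'cV[{poly F}]_k) r
    of block_works a b G e da db vhat (size us) x
    & (forall x', (x < x')%N -> ~ block_works a b G e da db vhat (size us) x')
    & alg1 (gen_block a b G x.-1) db
        (residual_word a b G vhat us (size us + x).-1) w
    & size bl = x
    & gen_block a b G x.-1 *m (\mxcol_(j < x.-1.+1) bl`_j) = w
    & alg2 a b G e da db vhat (us ++ bl) r :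
    alg2 a b G e da db vhat us r
| Alg2Success us
    of (forall x, ~ block_works a b G e da db vhat (size us) x)
    & size us = da.+1 :
    alg2 a b G e da db vhat us
      (Some (unslice a b us, G *m unslice a b us))
| Alg2Failure us
    of (forall x, ~ block_works a b G e da db vhat (size us) x)
    & size us <> da.+1 :
    alg2 a b G e da db vhat us None.

(* Main.v *)
Require Import Defs.
From mathcomp Require Import all_boot all_order all_algebra.
From Stdlib Require Import Classical_Prop.

(* A received slice whose window is decodable is recovered uniquely: a parity
   check H of the closure has a polynomial right inverse, so a vector killed by H
   modulo z^(j+1) agrees modulo z^(j+1) with a codeword, whose weight is bounded
   below by the column distance. The slices u_0, ..., u_(s-1) being known, v_N
   minus their contribution is the image of (u_s, ..., u_N) under
   [G_(N-s), ..., G_0]. If s is at most d_alpha, then j_(r-1) < s <= j_r for some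
   r; the columns [G_(j_r-s), ..., G_0] generate a subcode of the code in which
   slice j_r is decodable, and subcodes have larger column distances, so the
   algorithm never stops early, whichever blocks it selected before. *)

Set Implicit Arguments.
Unset Strict Implicit.
Unset Printing Implicit Defensive.
Import GRing.Theory.
Local Open Scope ring_scope.

(** * Polynomial matrices *)

(** With [g] the gcd of the entries [a] and [b], the Bezout coefficients form the first row of [A]
    and [(-b/g, a/g)] the second. The determinant is 1, so the inverse [B] is written down
    explicitly. *)
Lemma bezout_elimination2 (F : fieldType) (x : 'cV[{poly F}]_2) :
  exists2 A, A \in unitmx & (A *m x) ord_max 0 = 0.
Proof.
have [x0|x_n0] := eqVneq x 0.
  by exists 1%:M; rewrite ?unitmx1 // x0 mulmx0 mxE.
set a := x 0 0; set b := x ord_max 0; pose g := gcdp a b.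
have [[s t] /= /eqpP[[c1 c2] /= /andP[c1n0 c2n0] bez]] := Bezoutp a b.
have g_n0 : g != 0.
  rewrite gcdp_eq0; apply: contraNN x_n0 => /andP[/eqP a0 /eqP b0].
  apply/eqP/matrixP => i j; rewrite mxE (ord1 j).
  by case: i => [[|[]]] // le_i2; [rewrite -[RHS]a0 | rewrite -[RHS]b0];
    congr (x _ _); apply: val_inj.
(* [Bezoutp] gives the gcd only up to a nonzero scalar; [c] rescales the coefficients so that the
   combination is exactly [g]. *)
pose c := c2^-1 * c1; pose p := a %/ g; pose q := b %/ g.
have def_a : a = p * g by rewrite divpK // dvdp_gcdl.
have def_b : b = q * g by rewrite divpK // dvdp_gcdr.
have det1 : c *: s * p + c *: t * q = 1.
  apply: (mulIf g_n0); rewrite mul1r mulrDl -!mulrA -def_a -def_b.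
  by rewrite -!scalerAl -scalerDr /c -scalerA bez scalerA mulVf ?scale1r.
pose A : 'M[{poly F}]_2 := \matrix_(i, j)
  (if i == 0 then if j == 0 then c *: s else c *: t
   else if j == 0 then - q else p).
pose B : 'M[{poly F}]_2 := \matrix_(i, j)
  (if i == 0 then if j == 0 then p else - (c *: t)
   else if j == 0 then q else c *: s).
exists A.
  have AB1 : A *m B = 1%:M.
    apply/matrixP => i j; rewrite !mxE !big_ord_recl big_ord0 !mxE /= addr0.
    case: i => [[|[]]] // lei; case: j => [[|[]]] // lej /=; rewrite -?val_eqE /=.
    - by rewrite mulrN mulrC addrC -[c *: t * _]mulrC subrr.
    - by rewrite mulNr mulrC addrC [p * q]mulrC subrr.
    by rewrite mulrNN addrC [p * _]mulrC [q * _]mulrC det1.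
  by case/mulmx1_unit: AB1.
rewrite !mxE !big_ord_recl big_ord0 !mxE /= addr0.
rewrite (_ : lift _ _ = ord_max :> 'I_2); last exact: val_inj.
by rewrite -/a -/b def_a def_b mulNr !mulrA [q * p]mulrC addrC subrr.
Qed.

(** The induction hypothesis leaves at most one nonzero entry in the tail, its first. A 2 by 2
    elimination on the top two entries then clears it. *)
Lemma unimodular_column_reduction (F : fieldType) (m : nat)
    (c : 'cV[{poly F}]_m.+1) :
  exists2 U, U \in unitmx & forall i : 'I_m.+1, (0 < i)%N -> (U *m c) i 0 = 0.
Proof.
elim: m c => [|m IHm] c.
  by exists 1%:M; [exact: unitmx1 | case=> [[]]].
rewrite -[m.+2]/(1 + m.+1)%N in c *.
have [U Uunit zU] := IHm (dsubmx c).
pose W : 'M[{poly F}]_(1 + m.+1) := block_mx 1%:M 0 0 U.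
pose d : 'cV[{poly F}]_(2 + m) := W *m c.
have [A Aunit zA] := bezout_elimination2 (usubmx d).
pose V : 'M[{poly F}]_(2 + m) := block_mx A 0 0 1%:M.
have d_d : dsubmx d = 0.
  apply/matrixP => i j; rewrite (ord1 j) [LHS]mxE [RHS]mxE.
  transitivity ((W *m c) (rshift 1 (rshift 1 i)) 0).
    by congr (_ _ _); exact: val_inj.
  by rewrite -[c]vsubmxK mul_block_col col_mxEd mul0mx add0r zU.
exists (V *m W).
  have Vunit : V \in unitmx by rewrite unitmxE det_ublock det1 mulr1 -unitmxE.
  have Wunit : W \in unitmx by rewrite unitmxE det_ublock det1 mul1r -unitmxE.
  by rewrite unitmx_mul Vunit.
have Vd : V *m d = col_mx (A *m usubmx d) 0.
  by rewrite -{1}[d]vsubmxK d_d mul_block_col !mulmx0 mul0mx !addr0.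
move=> i i_gt0; rewrite -mulmxA -[W *m c]/d Vd.
move: i i_gt0; rewrite -[(1 + m.+1)%N]/(2 + m)%N => i.
rewrite -[i]splitK; case: (split i) => i' /=.
  rewrite col_mxEu => i_gt0; rewrite (_ : i' = ord_max) //; apply: val_inj => /=.
  by case: i' i_gt0 => [[|[]]].
by rewrite col_mxEd mxE.
Qed.

Lemma unimodular_triangularization (F : fieldType) (m k : nat)
    (M : 'M[{poly F}]_(m, k)) :
  exists2 U, U \in unitmx
    & forall (i : 'I_m) (j : 'I_k), (j < i)%N -> (U *m M) i j = 0.
Proof.
elim: k m M => [|k IHk] m M.
  by exists 1%:M; [exact: unitmx1 | move=> i []].
case: m M => [|m] M; first by exists 1%:M; [exact: unitmx1 | case].
rewrite -[m.+1]/(1 + m)%N -[k.+1]/(1 + k)%N in M *.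
have [U Uunit zU] := unimodular_column_reduction (lsubmx M).
pose N : 'M_(1 + m, 1 + k) := U *m M.
have [V Vunit zV] := IHk m (drsubmx N).
pose W : 'M[{poly F}]_(1 + m) := block_mx 1%:M 0 0 V.
exists (W *m U).
  have Wunit : W \in unitmx by rewrite unitmxE det_ublock det1 mul1r -unitmxE.
  by rewrite unitmx_mul Wunit.
have dlN : dlsubmx N = 0.
  apply/matrixP => r s; rewrite [RHS]mxE -(zU (rshift 1 r)) // !mxE.
  apply: eq_bigr => t _; rewrite !mxE.
  by congr (_ * M _ _); apply: val_inj; rewrite /= (ord1 s).
have WN : W *m N = block_mx (ulsubmx N) (ursubmx N) 0 (V *m drsubmx N).
  rewrite -{1}[N]submxK dlN mulmx_block.
  by rewrite !mul1mx !mul0mx !mulmx0 !add0r !addr0.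
move=> i j; rewrite -mulmxA -[U *m M]/N WN -[i]splitK -[j]splitK.
case: (split i) => i' /=; first by rewrite (ord1 i') ltn0.
case: (split j) => j' /=; rewrite ?block_mxEdl ?block_mxEdr ?mxE //.
by rewrite !add1n ltnS => lt_ji; rewrite -[RHS](zV i' j') // mxE.
Qed.

(** After triangularization, the rows from [k] on lie strictly below the diagonal and hence vanish.
    Factorizations, parity checks and one-sided inverses all come from this decomposition. *)
Lemma unimodular_row_compression (F : fieldType) (m k : nat)
    (M : 'M[{poly F}]_(k + m, k)) :
  exists2 U, U \in unitmx & exists R : 'M_k, M = U *m col_mx R 0.
Proof.
have [U Uunit zU] := unimodular_triangularization M.
exists (invmx U); rewrite ?unitmx_inv //; exists (usubmx (U *m M)).
have -> : 0 = dsubmx (U *m M).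
  by apply/matrixP=> i j; rewrite [LHS]mxE mxE zU //= ltn_addr.
by rewrite vsubmxK mulKmx.
Qed.

(** * Full column rank, primeness, parity checks, closures and column distances *)

Lemma full_col_rankP (R : idomainType) (n k : nat) (M : 'M[R]_(n, k)) :
  full_col_rank M <->
  exists B, B *m map_mx (@FracField.tofrac R) M = 1%:M.
Proof. by split=> [/eqP/row_fullP | /row_fullP/eqP]. Qed.

Lemma full_col_rank_inj (R : idomainType) (n k p : nat) (M : 'M[R]_(n, k)) :
  full_col_rank M -> injective (@mulmx R n k p M).
Proof.
case/full_col_rankP => B BM1 x y eqMxy.
have /matrixP eqxy : map_mx (@FracField.tofrac R) x = map_mx (@FracField.tofrac R) y.
  by rewrite -[LHS]mul1mx -[RHS]mul1mx -BM1 -!mulmxA -!map_mxM eqMxy.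
by apply/matrixP => i j; have /eqP := eqxy i j; rewrite !mxE tofrac_eq => /eqP.
Qed.

Lemma full_col_rank_mulr (R : idomainType) (n k p : nat) (M : 'M[R]_(n, k))
    (P : 'M[R]_(k, p)) (Q : 'M[R]_(p, k)) :
  full_col_rank M -> Q *m P = 1%:M -> full_col_rank (M *m P).
Proof.
move=> /full_col_rankP[B BM1] QP1; apply/full_col_rankP.
exists (map_mx (@FracField.tofrac R) Q *m B).
by rewrite map_mxM mulmxA -[_ *m B *m _]mulmxA BM1 mulmx1 -map_mxM QP1 map_mx1.
Qed.

Lemma full_col_rank_det (R : idomainType) (n k : nat) (A : 'M[R]_(n, k))
    (X : 'M[R]_k) :
  full_col_rank (A *m X) -> \det X != 0.
Proof.
case/full_col_rankP => B; rewrite map_mxM mulmxA => /mulmx1_unit[_].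
by rewrite unitmxE det_map_mx unitfE tofrac_eq0.
Qed.

Lemma mulmxr_det_eq0 (R : idomainType) (n k : nat) (A : 'M[R]_(n, k))
    (X : 'M[R]_k) :
  \det X != 0 -> A *m X = 0 -> A = 0.
Proof.
move=> detX_n0 AX0; have : A *m X *m \adj X = 0 by rewrite AX0 mul0mx.
rewrite -mulmxA mul_mx_adj mul_mx_scalar => /matrixP dA0.
apply/matrixP => i j; have /eqP := dA0 i j.
by rewrite !mxE mulf_eq0 (negPf detX_n0) => /eqP.
Qed.

Lemma right_prime_left_inverse (F : fieldType) (n k : nat)
    (M : 'M[{poly F}]_(n, k)) (L : 'M[{poly F}]_(k, n)) :
  L *m M = 1%:M -> right_prime M.
Proof. by move=> LM1 A Y defM; move: LM1; rewrite defM mulmxA => /mulmx1_unit[]. Qed.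

Lemma left_prime_right_inverse (F : fieldType) (m n : nat)
    (H : 'M[{poly F}]_(m, n)) (K : 'M[{poly F}]_(n, m)) :
  H *m K = 1%:M -> left_prime H.
Proof. by move=> HK1 Y A defH; move: HK1; rewrite defH -mulmxA => /mulmx1_unit[]. Qed.

(** Row compression of the transpose splits off a square left factor [R^T] from [H]. Left primeness
    makes this factor unimodular, and what remains is the top of a unimodular matrix. *)
Lemma left_prime_has_right_inverse (F : fieldType) (m n : nat)
    (H : 'M[{poly F}]_(m, n)) :
  (m <= n)%N -> left_prime H -> exists K, H *m K = 1%:M.
Proof.
move=> /subnKC; move: (n - m)%N => p def_n; case: n / def_n H => H lpH.
have [U Uunit [R defHT]] := unimodular_row_compression H^T.
have defH : H = R^T *m (row_mx 1%:M 0 *m U^T).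
  rewrite mulmxA mul_mx_row mulmx1 mulmx0 -[0]trmx0 -tr_col_mx -trmx_mul.
  by rewrite -defHT trmxK.
have RTunit := lpH _ _ defH.
exists (invmx U^T *m col_mx (invmx R^T) 0).
rewrite defH -!mulmxA mulKVmx ?unitmx_tr // mul_row_col mul1mx mulmx0 addr0.
by rewrite mulmxV.
Qed.

(** Write [M] as [U] times [R] stacked on zero, and let [V] be the inverse of [U]. The columns of
    [U] split into [Mt] and [K], the rows of [V] into [L] and [H]. The blocks of [V U = 1] give the
    identities and [U V = 1] the kernel; [X] is [R]. *)
Lemma right_prime_factorization (F : fieldType) (n k m : nat)
    (M : 'M[{poly F}]_(n, k)) :
  n = (k + m)%N -> full_col_rank M ->
  exists (Mt : 'M_(n, k)) (X : 'M_k) (L : 'M_(k, n)) (H : 'M_(m, n))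
      (K : 'M_(n, m)),
    [/\ L *m Mt = 1%:M, M = Mt *m X, \det X != 0,
        H *m K = 1%:M /\ H *m Mt = 0
      & forall w : 'cV_n, H *m w = 0 -> exists x, w = Mt *m x].
Proof.
move=> def_n; subst n => fullM.
have [U Uunit [R defM]] := unimodular_row_compression M.
have defM' : M = lsubmx U *m R.
  by rewrite {1}defM -{1}[U]hsubmxK mul_row_col mulmx0 addr0.
have [V VU1 UV1] : exists2 V, V *m U = 1%:M & U *m V = 1%:M.
  by exists (invmx U); rewrite ?mulVmx ?mulmxV.
exists (lsubmx U), R, (usubmx V), (dsubmx V), (rsubmx U).
have := VU1.
rewrite -{1}[V]vsubmxK -{1}[U]hsubmxK mul_col_row scalar_mx_block.
case/eq_block_mx => LM1 _ HM0 HK1; split=> // [|w Hw0].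
  by apply: (@full_col_rank_det _ _ _ (lsubmx U)); rewrite -defM'.
exists (usubmx V *m w); rewrite -{1}[w]mul1mx -UV1 -mulmxA.
by rewrite -{1}[V]vsubmxK mul_col_mx Hw0 -{1}[U]hsubmxK mul_row_col mulmx0 addr0.
Qed.

(** [nc_closure] admits any factorization of [M], so [H] must kill each right prime factor [Mt'],
    not only the one constructed. This holds because [H Mt' X' = H M = 0] and the nonsingular [X']
    cancels. *)
Lemma parity_check_exists (F : fieldType) (n k : nat)
    (M : 'M[{poly F}]_(n, k)) :
  (k <= n)%N -> full_col_rank M -> exists H, parity_check M H.
Proof.
move=> le_kn fullM; have def_n := esym (subnKC le_kn).
have [Mt [X [L [H [K [LMt1 defM detX [HK1 HMt0] kerH]]]]]] :=
  right_prime_factorization def_n fullM.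
exists H; split=> [|w]; first exact: left_prime_right_inverse HK1.
split=> [[Mt' [X' [_ detX' defM' [x ->]]]] | Hw0].
  have HMt'0 : H *m Mt' = 0.
    apply: (mulmxr_det_eq0 detX').
    by rewrite -mulmxA -defM' defM mulmxA HMt0 mul0mx.
  by rewrite mulmxA HMt'0 mul0mx.
exists Mt, X; split=> //; first exact: right_prime_left_inverse LMt1.
exact: kerH.
Qed.

Lemma nc_closure_image (F : fieldType) (n k : nat) (M : 'M[{poly F}]_(n, k))
    (x : 'cV[{poly F}]_k) :
  (k <= n)%N -> full_col_rank M -> nc_closure M (M *m x).
Proof.
move=> le_kn fullM; have def_n := esym (subnKC le_kn).
have [Mt [X [L [H [K [LMt1 defM detX _ _]]]]]] :=
  right_prime_factorization def_n fullM.
exists Mt, X; split=> //; first exact: right_prime_left_inverse LMt1.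
by exists (X *m x); rewrite mulmxA -defM.
Qed.

(** A parity check of [M] kills [M P], hence, after cancelling the nonsingular factor, the right
    prime factor of [M P]. So passing to a subcode shrinks the closure. *)
Lemma nc_closure_mulr (F : fieldType) (n k p : nat) (M : 'M[{poly F}]_(n, k))
    (P : 'M[{poly F}]_(k, p)) (w : 'cV[{poly F}]_n) :
  (k <= n)%N -> full_col_rank M -> nc_closure (M *m P) w -> nc_closure M w.
Proof.
move=> le_kn fullM [Mt [X [_ detX defMP [x ->]]]].
have [H [_ kerH]] := parity_check_exists le_kn fullM.
have HM0 : H *m M = 0.
  apply/matrixP => i j; have /kerH/matrixP/(_ i 0) :=
    nc_closure_image (delta_mx j 0) le_kn fullM.
  by rewrite mulmxA -colE !mxE.
have HMt0 : H *m Mt = 0.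
  by apply: (mulmxr_det_eq0 detX); rewrite -mulmxA -defMP mulmxA HM0 mul0mx.
by apply/kerH; rewrite mulmxA HMt0 mul0mx.
Qed.

(** Evaluating [L Mt = 1] at zero shows that [Mt(0)] has no zero column, so a column of [Mt] is such
    a word. It makes the minimum defining a column distance range over a nonempty set. *)
Lemma nc_closure_coef0_neq0 (F : fieldType) (n k : nat)
    (M : 'M[{poly F}]_(n, k)) :
  (0 < k <= n)%N -> full_col_rank M ->
  exists2 w, nc_closure M w & coef_cv w 0 != 0.
Proof.
case/andP=> k_gt0 le_kn fullM; have def_n := esym (subnKC le_kn).
have [Mt [X [L [H [K [LMt1 defM detX _ _]]]]]] :=
  right_prime_factorization def_n fullM.
pose c := Ordinal k_gt0; exists (col c Mt).
  exists Mt, X; split=> //; first exact: right_prime_left_inverse LMt1.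
  by exists (delta_mx c 0); rewrite -colE.
apply/eqP => /matrixP w0_eq0; have /matrixP/(_ c c)/(congr1 (coefp 0)) := LMt1.
rewrite !mxE eqxx /= coef1 coef_sum big1 ?eqxx => [/eqP|r _].
  by rewrite eq_sym oner_eq0.
by have := w0_eq0 r 0; rewrite !mxE coef0M => ->; rewrite mulr0.
Qed.

(** Descent on a bound for the weight; excluded middle is used since [D] is an arbitrary
    predicate. *)
Lemma col_distance_exists (F : fieldType) (n : nat)
    (D : 'cV[{poly F}]_n -> Prop) (j : nat) :
  (exists2 w, D w & coef_cv w 0 != 0) -> exists d, col_distance D j d.
Proof.
case=> w; have [d] := ubnPleq (\sum_(t < j.+1) hamming_wt (coef_cv w t)).
elim: d w => [|d IHd] w wt_le Dw w0_n0.
  exists 0%N; split=> //; exists w; split=> //; apply/eqP.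
  by rewrite -leqn0.
have [[w' [Dw' w'0 le_w']]|no_w'] := classic (exists w', [/\ D w',
    coef_cv w' 0 != 0 & (\sum_(t < j.+1) hamming_wt (coef_cv w' t) <= d)%N]).
  exact: (IHd w').
exists d.+1; split=> [|w' Dw' w'0].
  exists w; split=> //; apply/eqP; rewrite eqn_leq wt_le ltnNge /=.
  by apply/negP => le_wd; apply: no_w'; exists w.
by rewrite ltnNge; apply/negP => le_wd; apply: no_w'; exists w'.
Qed.

(** * One-dimensional decoding *)

Lemma coef_cvZXn (F : fieldType) (n i t : nat) (w : 'cV[{poly F}]_n) :
  coef_cv ('X^i *: w) (i + t) = coef_cv w t.
Proof.
by apply/matrixP => c r; rewrite !mxE coefXnM ltnNge leq_addr addKn.
Qed.

Lemma coef_cvB (F : fieldType) (n t : nat) (w w' : 'cV[{poly F}]_n) :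
  coef_cv (w - w') t = coef_cv w t - coef_cv w' t.
Proof. by apply/matrixP => c r; rewrite !mxE coefB. Qed.

Lemma coef_cv_shift (F : fieldType) (n i : nat) (w : 'cV[{poly F}]_n) :
  (forall t, (t < i)%N -> coef_cv w t = 0) -> exists w', w = 'X^i *: w'.
Proof.
move=> w_lt0; exists (map_mx (drop_poly i) w); apply/matrixP => c r.
apply/polyP => t; rewrite (ord1 r) !mxE coefXnM coef_drop_poly.
case: ltnP => [lt_ti | le_it]; last by rewrite subnK.
by have /matrixP/(_ c 0) := w_lt0 t lt_ti; rewrite !mxE.
Qed.

(** Since [received_coef] is [Some 0] beyond [s], consistency also forces [w] to have degree at most
    [s]. *)
Definition consistent (F : fieldType) (n s : nat)
    (what : nat -> 'I_n -> option F) (w : 'cV[{poly F}]_n) :=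
  forall t c, received_coef s what t c = None
           \/ received_coef s what t c = Some (w c 0)`_t.

Lemma consistent_coef_gt (F : fieldType) (n s : nat)
    (what : nat -> 'I_n -> option F) (w : 'cV[{poly F}]_n) t c :
  consistent s what w -> (s < t)%N -> (w c 0)`_t = 0.
Proof.
move=> /(_ t c) + lt_st; rewrite /received_coef leqNgt lt_st /=.
by case=> [|[]].
Qed.

(** Where a symbol arrived, [W] and [w] both equal it, so the error is supported on the erased
    positions. *)
Lemma wt_error_le_erasures (F : fieldType) (n s : nat)
    (what : nat -> 'I_n -> option F) (w W : 'cV[{poly F}]_n) t :
  consistent s what w ->
  (forall c a, received_coef s what t c = Some a -> coef_cv W t c 0 = a) ->
  (hamming_wt (coef_cv (W - w) t) <= erasures s what t)%N.
Proof.
move=> cons_w W_t; apply/subset_leq_card/subsetP => c; rewrite !inE.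
case: (cons_w t c) => [-> // | /[dup] recv -> /=].
by rewrite coef_cvB mxE (W_t c _ recv) !mxE subrr eqxx.
Qed.

(* A right inverse K of H turns the truncation of a vector killed by H modulo
   z^(j+1) into that of a genuine codeword, to which d_j^c applies. *)
Lemma window_solution_unique (F : fieldType) (n k s : nat)
    (M : 'M[{poly F}]_(n, k)) (H : 'M[{poly F}]_(n - k, n))
    (what : nat -> 'I_n -> option F) (w p W : 'cV[{poly F}]_n) (i j : nat) :
  parity_check M H -> H *m w = 0 -> consistent s what w ->
  (forall t, (t < i)%N -> coef_cv p t = coef_cv w t) ->
  window_decodable s M what i j -> window_solution s H what i j p W ->
  coef_cv W i = coef_cv w i.
Proof.
move=> [lpH kerH] Hw0 cons_w p_w [d [_ d_min] lt_d] [W_lt W_recv HW].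
have [K HK1] := left_prime_has_right_inverse (leq_subr k n) lpH.
have lt_i t : (t < i)%N -> coef_cv (W - w) t = 0.
  by move=> lt_ti; rewrite coef_cvB W_lt // p_w // subrr.
have [y def_y] := coef_cv_shift lt_i.
have [g def_g] : exists g, H *m y = 'X^(j.+1) *: g.
  apply: coef_cv_shift => t lt_tj.
  rewrite -(coef_cvZXn i) scalemxAr -def_y mulmxBr Hw0 subr0 HW //.
  by rewrite leq_addr leq_add2l -ltnS.
pose w' := y - 'X^(j.+1) *: (K *m g).
have w'_y t : (t <= j)%N -> coef_cv w' t = coef_cv (W - w) (i + t).
  move=> le_tj; rewrite def_y coef_cvZXn coef_cvB.
  rewrite [X in _ - X](_ : _ = 0) ?subr0 //.
  by apply/matrixP => c r; rewrite !mxE coefXnM ltnS le_tj.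
have Dw' : nc_closure M w'.
  by apply/kerH; rewrite mulmxBr -scalemxAr mulmxA HK1 mul1mx def_g subrr.
apply/eqP; rewrite -subr_eq0 -coef_cvB -[i in coef_cv _ i]addn0 -w'_y //.
(* If the error had a nonzero coefficient at [i], the codeword [w'] would have weight at least [d]
   on the window, while erasures allow less than [d]. *)
apply: contraLR lt_d => w'0_n0; rewrite -leqNgt.
apply: leq_trans (d_min _ Dw' w'0_n0) _.
rewrite -addnS -{1}[i]add0n big_addn addKn big_mkord.
apply: leq_sum => t _; have le_tj : (t <= j)%N by rewrite -ltnS.
rewrite w'_y // addnC.
apply: wt_error_le_erasures => // c a; apply: W_recv.
by rewrite leq_addl addnC leq_add2l.
Qed.

(** The truncation of [w] is an invariant of every run, by uniqueness of window solutions.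
    Conversely [w] itself solves every window, so a complete run exists. *)
Lemma alg1P (F : fieldType) (n k s : nat) (M : 'M[{poly F}]_(n, k))
    (what : nat -> 'I_n -> option F) (w w' : 'cV[{poly F}]_n) :
  (k <= n)%N -> full_col_rank M -> nc_closure M w -> consistent s what w ->
  decodable s M what -> alg1 M s what w' <-> w' = w.
Proof.
move=> le_kn fullM Dw cons_w dec.
pose tr i := map_mx (take_poly i) w.
have tr_lt i t : (t < i)%N -> coef_cv (tr i) t = coef_cv w t.
  by move=> lt_ti; apply/matrixP => c r; rewrite !mxE coef_take_poly lt_ti.
have trS i W : coef_cv W i = coef_cv w i ->
    tr i + \col_c ((W c 0)`_i *: 'X^i) = tr i.+1.
  move=> /matrixP eqWi; apply/matrixP => c r; apply/polyP => t.
  have := eqWi c 0; rewrite (ord1 r) !mxE coefD coefZ coefXn !coef_take_poly => ->.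
  rewrite ltnS [in RHS]leq_eqVlt; case: eqVneq => [-> | _].
    by rewrite ltnn add0r mulr1.
  by rewrite mulr0 addr0.
have tr_end : tr s.+1 = w.
  apply/matrixP => c r; rewrite (ord1 r) mxE; apply/polyP => t.
  rewrite coef_take_poly ltnS; case: leqP => // lt_st.
  by rewrite (consistent_coef_gt _ cons_w lt_st).
have tr0 : tr 0%N = 0.
  by apply/matrixP => c r; rewrite !mxE; apply/polyP => t; rewrite coef_take_poly coef0.
split=> [[H pcH run] | ->].
  have [_ kerH] := pcH; have Hw0 := (kerH w).1 Dw.
  suff run_tr i p : alg1_run M H s what i p -> p = tr i.
    by rewrite (run_tr _ _ run).
  elim=> {i p} [|i j p W le_is _ -> win sol]; first by rewrite tr0.
  exact/trS/(window_solution_unique pcH Hw0 cons_w (tr_lt i) win sol).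
have [H pcH] := parity_check_exists le_kn fullM; exists H => //.
have Hw0 := (pcH.2 w).1 Dw.
suff run_tr i : (i <= s.+1)%N -> alg1_run M H s what i (tr i).
  by rewrite -[w]tr_end; exact: run_tr.
elim: i => [_|i IHi lt_is]; first by rewrite tr0; exact: Alg1Start.
(* The window solution used at this step is [w] itself. *)
have [j win] := dec i lt_is; rewrite -(trS i w) //.
apply: (Alg1Step (j := j)) => //; first exact/IHi/ltnW.
split=> [t lt_ti | t c a _ recv | t _]; first by rewrite tr_lt.
  by rewrite mxE; case: (cons_w t c); rewrite recv // => -[].
by rewrite Hw0; apply/matrixP => c r; rewrite !mxE coef0.
Qed.

Lemma decodable_erasures (F : fieldType) (n k s : nat) (M : 'M[{poly F}]_(n, k))
    (what what' : nat -> 'I_n -> option F) :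
  (forall t, erasures s what t = erasures s what' t) ->
  decodable s M what -> decodable s M what'.
Proof.
move=> eq_er dec i /dec[j [d cd lt_d]]; exists j, d => //.
by under eq_bigr do rewrite -eq_er.
Qed.

(** The closure of the subcode lies in that of the code, so its minima, the column distances, are at
    least as large. Positivity of [p] provides a word over which to take the minimum. *)
Lemma decodable_mulr (F : fieldType) (n k p s : nat) (M : 'M[{poly F}]_(n, k))
    (P : 'M[{poly F}]_(k, p)) (what : nat -> 'I_n -> option F) :
  (k <= n)%N -> (0 < p <= n)%N -> full_col_rank M -> full_col_rank (M *m P) ->
  decodable s M what -> decodable s (M *m P) what.
Proof.
move=> le_kn le_pn fullM fullMP dec i /dec[j [d [_ d_min] lt_d]].
have [d' [[w [Dw w0 wt_w]] d'_min]] :=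
  col_distance_exists j (nc_closure_coef0_neq0 le_pn fullMP).
exists j, d'; first by split=> //; exists w.
apply: leq_trans lt_d _; rewrite -wt_w; apply: d_min => //.
exact: nc_closure_mulr Dw.
Qed.

(** Decodability involves a column distance attained by a word with nonzero constant coefficient,
    and the zero code has none. *)
Lemma decodable_pos (F : fieldType) (n k s : nat) (M : 'M[{poly F}]_(n, k))
    (what : nat -> 'I_n -> option F) :
  decodable s M what -> (0 < k)%N.
Proof.
case/(_ 0%N isT) => j [d [[w [[Mt [X [_ _ _ [x ->]]]] + _]] _] _].
case: k => [|//] in M Mt X x *; rewrite [x]flatmx0 mulmx0.
by case/eqP; apply/matrixP => c r; rewrite !mxE coef0.
Qed.

(** * Slices of bivariate polynomials *)

Lemma ord2_eq (a b i : 'I_2) : a != b -> i != a -> i = b.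
Proof.
by move=> ab ia; apply: val_inj; move: a b i ab ia => [[|[]]] // ? [[|[]]] // ? [[|[]]].
Qed.

Lemma mnm2E (a b : 'I_2) (i t : nat) :
  a != b -> ((U_(a) *+ i + U_(b) *+ t)%MM a = i)
          * ((U_(a) *+ i + U_(b) *+ t)%MM b = t).
Proof.
move=> ab; rewrite !mnmDE !mulmnE !mnm1E !eqxx (negPf ab) eq_sym (negPf ab).
by rewrite !mul1n !mul0n addn0.
Qed.

Lemma mnm2_eqE (a b : 'I_2) (m : 'X_{1.. 2}) (i t : nat) :
  a != b -> (m == (U_(a) *+ i + U_(b) *+ t)%MM) = (m a == i) && (m b == t).
Proof.
move=> ab; apply/eqP/andP => [-> | [/eqP <- /eqP <-]].
  by rewrite !mnm2E.
apply/mnmP => r; rewrite mnmDE !mulmnE !mnm1E; have [-> | /(ord2_eq ab) ->] := eqVneq r a.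
  by rewrite eq_sym (negPf ab) mul1n addn0.
by rewrite eqxx mul1n.
Qed.

(* {mpoly F[2]} as polynomials in z_a over F[z_b]. *)
Definition bivar (F : fieldType) (a : 'I_2) :
    {rmorphism {mpoly F[2]} -> {poly {poly F}}} :=
  mmap (polyC \o polyC) (fun r => if r == a then 'X else 'X%:P).

Lemma bivarC (F : fieldType) (a : 'I_2) (x : F) :
  bivar F a (mpolyC 2 x) = x%:P%:P.
Proof. exact: mmapC. Qed.

Lemma bivarX (F : fieldType) (a r : 'I_2) :
  bivar F a 'X_r = if r == a then 'X else 'X%:P.
Proof. by rewrite /= mmapX mmap1U. Qed.

Lemma coef_bivar (F : fieldType) (a b : 'I_2) (p : {mpoly F[2]}) (i t : nat) :
  a != b -> (bivar F a p)`_i`_t = p@_(U_(a) *+ i + U_(b) *+ t)%MM.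
Proof.
move=> ab; rewrite /= /mmap !coef_sum.
have coef_term m : (((polyC \o polyC) p@_m *
    mmap1 (fun r => if r == a then 'X else 'X%:P) m : {poly {poly F}})`_i)`_t
    = p@_m * ((m a == i) && (m b == t))%:R.
  rewrite /mmap1 (bigD1 a) //= (bigD1 b) //=; last by rewrite eq_sym.
  rewrite big1 ?mulr1 => [|r /andP[/(ord2_eq ab) ->]]; last by rewrite eqxx.
  rewrite eqxx eq_sym (negPf ab) -rmorphXn coefCM coefMC coefXn coefCM.
  rewrite [i == _]eq_sym; case: eqP => _; last by rewrite mul0r coef0.
  by rewrite mul1r coefXn eq_sym.
transitivity (\sum_(m <- msupp p) p@_m * ((m a == i) && (m b == t))%:R).
  by apply: eq_bigr => m _; rewrite coef_term.
set m0 := (U_(a) *+ i + U_(b) *+ t)%MM.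
under eq_bigr do rewrite -mnm2_eqE //.
have [m0p | m0p] := boolP (m0 \in msupp p).
  rewrite (bigD1_seq m0) ?msupp_uniq //= eqxx mulr1 big1 ?addr0 // => m m_n0.
  by rewrite (negPf m_n0) mulr0.
rewrite (memN_msupp_eq0 m0p) big_seq big1 // => m mp.
by case: eqP mp => [-> | _ _]; rewrite ?mulr0 // (negPf m0p).
Qed.

Lemma coef_slice (F : fieldType) (a b : 'I_2) (p : {mpoly F[2]}) (i t : nat) :
  a != b -> (slice a b p i)`_t = p@_(U_(a) *+ i + U_(b) *+ t)%MM.
Proof.
move=> ab; rewrite coef_poly; case: ltnP => // le_pt.
apply/esym/memN_msupp_eq0/msize_mdeg_ge/(leq_trans le_pt).
by rewrite mdegD !mdegMn !mdeg1 !mul1n leq_addl.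
Qed.

Lemma sliceE (F : fieldType) (a b : 'I_2) (p : {mpoly F[2]}) (i : nat) :
  a != b -> slice a b p i = (bivar F a p)`_i.
Proof. by move=> ab; apply/polyP => t; rewrite coef_slice // (coef_bivar _ _ _ ab). Qed.

Lemma bivar_inj (F : fieldType) (a b : 'I_2) :
  a != b -> injective (bivar F a).
Proof.
move=> ab p q eq_pq; apply/mpolyP => m.
have /eqP -> : m == (U_(a) *+ m a + U_(b) *+ m b)%MM by rewrite mnm2_eqE ?eqxx.
by rewrite -!(coef_bivar _ _ _ ab) eq_pq.
Qed.

(** Through [bivar], slices are coefficients of polynomials in [z_a], and this is the Cauchy
    product. *)
Lemma slice_mx_mulmx (F : fieldType) (a b : 'I_2) (n k p : nat)
    (A : 'M[{mpoly F[2]}]_(n, k)) (B : 'M[{mpoly F[2]}]_(k, p)) (i : nat) :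
  a != b ->
  slice_mx a b (A *m B) i =
  \sum_(m < i.+1) slice_mx a b A (i - m) *m slice_mx a b B m.
Proof.
move=> ab; apply/matrixP => r c; rewrite !mxE sliceE // summxE rmorph_sum coef_sum.
under [RHS]eq_bigr do rewrite mxE.
rewrite exchange_big; apply: eq_bigr => s _; rewrite rmorphM coefMr.
by apply: eq_bigr => m _; rewrite !mxE !sliceE.
Qed.

Lemma bivar_map_horner (F : fieldType) (a b : 'I_2) (p : {poly F}) :
  a != b -> bivar F a (map_poly (@mpolyC 2 F) p).['X_b] = p%:P.
Proof.
move=> ab; rewrite -horner_map bivarX eq_sym (negPf ab) -map_poly_comp.
rewrite (eq_map_poly (g := polyC \o polyC)) => [|x]; last exact: bivarC.
by rewrite map_poly_comp horner_map -[_.['X]]/(p \Po 'X) comp_polyXr.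
Qed.

(** The list may be longer than the degree of [u] requires: only [d_alpha] is known to the receiver,
    and the surplus slices are zero. *)
Lemma unslice_slices (F : fieldType) (a b : 'I_2) (k s : nat)
    (u : 'cV[{mpoly F[2]}]_k) :
  a != b -> (forall i, (s <= i)%N -> slice_mx a b u i = 0) ->
  unslice a b (mkseq (slice_mx a b u) s) = u.
Proof.
move=> ab u_ge; apply/matrixP => r c; rewrite (ord1 c) mxE size_mkseq.
apply: (bivar_inj ab); rewrite rmorph_sum; apply/polyP => i.
rewrite -(sliceE _ _ ab) coef_sum.
under eq_bigr do
  rewrite rmorphM rmorphXn bivar_map_horner // nth_mkseq ?ltn_ord // coefCM.
under eq_bigr do rewrite bivarX eqxx coefXn mxE.
have [le_si | lt_is] := leqP s i.
  have /matrixP/(_ r 0) := u_ge i le_si; rewrite !mxE => ->.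
  by apply: big1 => j _; rewrite gtn_eqF ?mulr0 // (leq_trans _ le_si).
rewrite (bigD1 (Ordinal lt_is)) //= eqxx mulr1 big1 ?addr0 // => j.
by rewrite -val_eqE /= eq_sym => /negPf ->; rewrite mulr0.
Qed.

Lemma deg_in_coef (F : fieldType) (a : 'I_2) (n k : nat)
    (A : 'M[{mpoly F[2]}]_(n, k)) r c (m : 'X_{1.. 2}) :
  (deg_in a A < m a)%N -> (A r c)@_m = 0.
Proof.
move=> lt_m; apply: memN_msupp_eq0; apply: contraL lt_m => mA.
rewrite -leqNgt (leq_trans _ (leq_bigmax r)) // (leq_trans _ (leq_bigmax c)) //.
exact: (leq_bigmax_seq (F := fun m : 'X_{1.. 2} => m a)).
Qed.

Lemma slice_mx_gt_deg (F : fieldType) (a b : 'I_2) (n k : nat)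
    (A : 'M[{mpoly F[2]}]_(n, k)) (i : nat) :
  a != b -> (deg_in a A < i)%N -> slice_mx a b A i = 0.
Proof.
move=> ab lt_i; apply/matrixP => r c; apply/polyP => t.
rewrite !mxE coef_slice // coef0; apply: (deg_in_coef (a := a)).
by rewrite (mnm2E _ _ ab).
Qed.

Lemma size_slice_mx (F : fieldType) (a b : 'I_2) (n k : nat)
    (A : 'M[{mpoly F[2]}]_(n, k)) (i : nat) r c :
  a != b -> (size (slice_mx a b A i r c) <= (deg_in b A).+1)%N.
Proof.
move=> ab; apply/leq_sizeP => t lt_t; rewrite mxE coef_slice //.
apply: (deg_in_coef (a := b)).
by rewrite (mnm2E _ _ ab).
Qed.

(** * Decoding the slices of a codeword *)

(** Indices decrease from left to right, so the shorter matrix consists of the last [y + 1] blocks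
    of the longer one. [P] selects these blocks, shifted by [e - y], and [Q] is the transposed
    selection. *)
Lemma gen_block_subcode (F : fieldType) (a b : 'I_2) (n k : nat)
    (G : 'M[{mpoly F[2]}]_(n, k)) (e y : nat) :
  (y <= e)%N ->
  exists P Q, gen_block a b G y = gen_block a b G e *m P /\ Q *m P = 1%:M.
Proof.
move=> le_ye; pose sel (i j : nat) : 'M[{poly F}]_k := (i == (j + (e - y))%N)%:R%:M.
pose P := \mxblock_(i < e.+1, j < y.+1) sel i j.
exists P, (\mxblock_(j < y.+1, i < e.+1) sel i j).
have lt_e (j : 'I_y.+1) : (j + (e - y) < e.+1)%N.
  by rewrite ltnS -{2}(subnKC le_ye) leq_add2r -ltnS.
split.
  rewrite mul_mxrow_mxblock; apply: eq_mxrow => j.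
  rewrite (bigD1 (Ordinal (lt_e j))) //= big1 ?addr0 => [|i].
    by rewrite /sel eqxx mulmx1; congr slice_mx; rewrite addnC subnDA subKn.
  by rewrite -val_eqE /sel => /= /negPf ->; rewrite raddf0 mulmx0.
(* The identity [Q P = 1] is checked on stacked blocks [z], then applied to the identity matrix. *)
suff QPz q (z : 'I_y.+1 -> 'M_(k, q)) :
    \mxblock_(j < y.+1, i < e.+1) sel i j *m (P *m \mxcol_j z j) = \mxcol_j z j.
  by rewrite -[LHS]mulmx1 -[1%:M]submxcolK -mulmxA QPz.
rewrite !mul_mxblock_mxrow; apply/eq_mxcolP => j.
rewrite (bigD1 (Ordinal (lt_e j))) //= [X in _ + X]big1 => [|i]; last first.
  by rewrite -val_eqE /sel => /= /negPf ->; rewrite raddf0 mul0mx.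
rewrite addr0 /sel eqxx mul1mx (bigD1 j) //= eqxx mul1mx [X in _ + X]big1.
  by rewrite addr0.
by move=> r; rewrite -val_eqE eqn_add2r eq_sym => /negPf ->; rewrite raddf0 mul0mx.
Qed.

(** Degrees in [z_b] add up to at most [d_beta]; this justifies the zeros that [received_coef]
    supplies beyond that degree. *)
Lemma coef_slice_mulmx_gt (F : fieldType) (a b : 'I_2) (n k p : nat)
    (G : 'M[{mpoly F[2]}]_(n, k)) (u : 'M[{mpoly F[2]}]_(k, p)) i m r c t :
  a != b -> (deg_in b G + deg_in b u < t)%N ->
  ((slice_mx a b G i *m slice_mx a b u m) r c)`_t = 0.
Proof.
move=> ab lt_t; rewrite mxE coef_sum big1 // => s _.
apply/nth_default/(leq_trans (size_polyMleq _ _))/(leq_trans _ lt_t).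
have sizeG := size_slice_mx G i r s ab; have sizeu := size_slice_mx u m s c ab.
by rewrite -subn1 leq_subLR add1n -addSn -addnS leq_add.
Qed.

(** The Cauchy sum is split at [s], between the slices of [u] already known and the next [y + 1]. *)
Lemma slice_mulmx_tail (F : fieldType) (a b : 'I_2) (n k : nat)
    (G : 'M[{mpoly F[2]}]_(n, k)) (u : 'cV[{mpoly F[2]}]_k) (s y : nat) :
  a != b ->
  slice_mx a b (G *m u) (s + y) =
    \sum_(m < s) slice_mx a b G (s + y - m) *m slice_mx a b u m
    + gen_block a b G y *m \mxcol_(j < y.+1) slice_mx a b u (s + j).
Proof.
move=> ab; rewrite slice_mx_mulmx // -addnS big_split_ord /= mul_mxrow_mxcol.
by congr (_ + _); apply: eq_bigr => j _; rewrite subnDl.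
Qed.

Lemma residual_consistent (F : fieldType) (a b : 'I_2) (n k : nat)
    (G : 'M[{mpoly F[2]}]_(n, k)) (u : 'cV[{mpoly F[2]}]_k) (da s y : nat)
    (vhat : nat -> nat -> 'I_n -> option F) :
  let db := (deg_in b G + deg_in b u)%N in
  a != b -> received a b da db (G *m u) vhat -> (s + y <= da)%N ->
  consistent db
    (residual_word a b G vhat (mkseq (slice_mx a b u) s) (s + y))
    (gen_block a b G y *m \mxcol_(j < y.+1) slice_mx a b u (s + j)).
Proof.
move=> db ab recv le_N t c; rewrite /received_coef; case: leqP => [le_t | lt_t].
  set T := gen_block a b G y *m _; rewrite /residual_word.
  set K := \sum_(m < _) _.
  have vN : slice a b ((G *m u) c 0) (s + y) = (K + T) c 0.
    transitivity (slice_mx a b (G *m u) (s + y) c 0); first by rewrite [RHS]mxE.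
    rewrite slice_mulmx_tail //; congr (fun_of_matrix (_ + _) c 0); rewrite /K size_mkseq.
    by apply: eq_bigr => m _; rewrite nth_mkseq.
  have [-> | ->] := recv (s + y)%N t c le_N le_t; [by left | right => /=].
  by rewrite vN mxE coefD addrC addKr.
right; congr Some; apply/esym; rewrite mul_mxrow_mxcol summxE coef_sum big1 // => j _.
exact: coef_slice_mulmx_gt.
Qed.

(** * Block choice and recovery in the two-dimensional algorithm *)

Lemma exists_largest (P : nat -> Prop) (m : nat) :
  (forall x, P x -> (x <= m)%N) -> (exists x, P x) ->
  exists2 x, P x & forall x', (x < x')%N -> ~ P x'.
Proof.
move=> P_le [x Px]; have [d] := ubnPleq (m - x)%N.
elim: d x Px => [|d IHd] x Px le_d.
  exists x => // x' lt_xx' Px'; move: le_d (P_le _ Px').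
  by rewrite leqn0 subn_eq0 => /leq_ltn_trans/(_ lt_xx'); rewrite ltnNge => /negPf ->.
have [[x' lt_xx' Px'] | noP] := classic (exists2 x', (x < x')%N & P x').
  apply: (IHd x') => //; rewrite -ltnS (leq_trans _ le_d) //.
  by rewrite ltn_sub2l // (leq_trans lt_xx') // P_le.
by exists x => // x' lt_xx' Px'; apply: noP; exists x'.
Qed.

Lemma admissible_gen_block (F : fieldType) (a b : 'I_2) (n k : nat)
    (G : 'M[{mpoly F[2]}]_(n, k)) (e y : nat) :
  admissible_block a b G e -> (y <= e)%N ->
  (\sum_(j < y.+1) k <= n)%N /\ full_col_rank (gen_block a b G y).
Proof.
move=> [lt_n full_e] le_ye; split.
  rewrite sum_nat_const card_ord (leq_trans _ (ltnW lt_n)) // mulnC leq_mul2l.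
  by rewrite ltnS le_ye orbT.
have [P [Q [-> QP1]]] := gen_block_subcode a b G le_ye.
exact: full_col_rank_mulr full_e QP1.
Qed.

(** A shorter block generates a subcode. Hence knowing more slices of [u] than planned never spoils
    the decodability of a slice of the received word. *)
Lemma decodable_gen_block_le (F : fieldType) (a b : 'I_2) (n k : nat)
    (G : 'M[{mpoly F[2]}]_(n, k)) (e x y db : nat)
    (what : nat -> 'I_n -> option F) :
  admissible_block a b G e -> (x <= y <= e)%N ->
  decodable db (gen_block a b G y) what -> decodable db (gen_block a b G x) what.
Proof.
move=> adm /andP[le_xy le_ye] dec.
have [le_yn full_y] := admissible_gen_block adm le_ye.
have [le_xn full_x] := admissible_gen_block adm (leq_trans le_xy le_ye).
have x_gt0 : (0 < \sum_(j < x.+1) k)%N.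
  move: (decodable_pos dec); rewrite !sum_nat_const !card_ord.
  by rewrite !muln_gt0.
have [P [Q [def_x _]]] := gen_block_subcode a b G le_xy.
rewrite def_x in full_x *.
by apply: decodable_mulr dec => //; rewrite x_gt0.
Qed.

Lemma erasures_residual_word (F : fieldType) (a b : 'I_2) (n k : nat)
    (G : 'M[{mpoly F[2]}]_(n, k)) (vhat : nat -> nat -> 'I_n -> option F)
    (us : seq 'cV[{poly F}]_k) (N db t : nat) :
  erasures db (residual_word a b G vhat us N) t = erasures db (vhat N) t.
Proof.
apply: eq_card => c; rewrite !inE /received_coef /residual_word.
by case: ifP => // _; case: (vhat N t c).
Qed.

Lemma alg1_residual_word (F : fieldType) (a b : 'I_2) (n k : nat)
    (G : 'M[{mpoly F[2]}]_(n, k)) (u : 'cV[{mpoly F[2]}]_k) (e da s x : nat)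
    (vhat : nat -> nat -> 'I_n -> option F) (w : 'cV[{poly F}]_n) :
  let db := (deg_in b G + deg_in b u)%N in
  a != b -> admissible_block a b G e -> received a b da db (G *m u) vhat ->
  block_works a b G e da db vhat s x ->
  alg1 (gen_block a b G x.-1) db
    (residual_word a b G vhat (mkseq (slice_mx a b u) s) (s + x).-1) w
  <-> w = gen_block a b G x.-1 *m \mxcol_(j < x.-1.+1) slice_mx a b u (s + j).
Proof.
move=> db ab adm recv []; case: x => [|y] // le_y; rewrite addnS /= => le_N dec.
have [le_n full_y] := admissible_gen_block adm le_y.
apply: alg1P => //; first exact: nc_closure_image.
  exact: (residual_consistent ab recv le_N).
by apply: decodable_erasures dec => t; rewrite erasures_residual_word.
Qed.

Lemma slices_of_block (F : fieldType) (a b : 'I_2) (n k : nat)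
    (G : 'M[{mpoly F[2]}]_(n, k)) (u : 'cV[{mpoly F[2]}]_k)
    (bl : seq 'cV[{poly F}]_k) (s y : nat) :
  full_col_rank (gen_block a b G y) -> size bl = y.+1 ->
  gen_block a b G y *m \mxcol_(j < y.+1) bl`_j
    = gen_block a b G y *m \mxcol_(j < y.+1) slice_mx a b u (s + j) ->
  mkseq (slice_mx a b u) s ++ bl = mkseq (slice_mx a b u) (s + y.+1).
Proof.
move=> full_y size_bl /(full_col_rank_inj full_y)/eq_mxcolP eq_bl.
apply: (@eq_from_nth _ 0); first by rewrite size_cat !size_mkseq size_bl.
move=> i; rewrite size_cat size_mkseq size_bl => lt_i.
rewrite nth_cat size_mkseq [RHS]nth_mkseq //; case: ltnP => [lt_is | le_si].
  by rewrite nth_mkseq.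
have lt_y : (i - s < y.+1)%N by rewrite ltn_subLR.
by rewrite (eq_bl (Ordinal lt_y)) /= subnKC.
Qed.

Lemma exists_block_works (F : fieldType) (a b : 'I_2) (n k : nat)
    (G : 'M[{mpoly F[2]}]_(n, k)) (e da db l s : nat)
    (vhat : nat -> nat -> 'I_n -> option F) (jj : nat -> nat) :
  admissible_block a b G e ->
  (forall r, (r < l)%N -> (jj r < jj r.+1)%N) -> jj l = da -> (jj 0%N <= e)%N ->
  (forall r, (r < l)%N -> (jj r.+1 - (jj r).+1 <= e)%N) ->
  decodable db (gen_block a b G (jj 0%N)) (vhat (jj 0%N)) ->
  (forall r, (r < l)%N ->
     decodable db (gen_block a b G (jj r.+1 - (jj r).+1)) (vhat (jj r.+1))) ->
  (s <= da)%N -> exists x, block_works a b G e da db vhat s x.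
Proof.
move=> adm jj_lt jj_l jj0_e gap_e dec0 decS le_s.
(* Downward induction from [jj l = da]. *)
have jj_le r : (r <= l)%N -> (jj r <= da)%N.
  move=> /subnKC; move: (l - r)%N => d; elim: d r => [|d IHd] r.
    by rewrite addn0 => ->; rewrite jj_l.
  rewrite addnS -addSn => def_l; apply/ltnW/(leq_trans (jj_lt r _))/IHd => //.
  by rewrite -def_l addSn ltnS leq_addr.
(* [N] is a slice decodable with the block of index [y]. The unknowns in it are [u_s, ..., u_N], so
   [x] is [N - s + 1] and the block actually used has index [N - s], at most [y]. *)
suff [y [N [le_sN le_N le_yN le_ye dec]]] : exists y N, [/\ (s <= N)%N,
    (N <= da)%N, (N - s <= y)%N, (y <= e)%N
    & decodable db (gen_block a b G y) (vhat N)].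
  exists (N - s).+1; rewrite /block_works addnS /= subnKC // ltnS.
  split=> //; first exact: leq_trans le_ye.
  by apply: (decodable_gen_block_le adm _ dec); rewrite le_yN.
have ex_r : exists r, (s <= jj r)%N by exists l; rewrite jj_l.
(* For the least [r] with [s <= jj r], minimality puts the previous index below [s], which bounds
   [N - s] by the gap. *)
case: (ex_minnP ex_r) => r le_sr min_r.
have le_rl : (r <= l)%N by apply: min_r; rewrite jj_l.
case: r => [|r] in le_sr min_r le_rl *.
  by exists (jj 0%N), (jj 0%N); split; rewrite ?leq_subr ?jj_le.
exists (jj r.+1 - (jj r).+1)%N, (jj r.+1); split=> //.
- exact: jj_le.
- by rewrite leq_sub2l // ltnNge; apply/negP => /min_r; rewrite ltnn.
- exact: gap_e.
exact: decS.
Qed.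

(** As [alg2] is a relation, recovery is an equivalence: no run ends with another result, and some
    run does end with [(u, v)]. *)
Theorem theorem3p1 (F : finFieldType) (n k : nat) (alpha beta : 'I_2)
    (G : 'M[{mpoly F[2]}]_(n, k)) (e : nat)
    (u : 'cV[{mpoly F[2]}]_k) (v : 'cV[{mpoly F[2]}]_n)
    (vhat : nat -> nat -> 'I_n -> option F) (l : nat) (jj : nat -> nat) :
  let d_alpha := (deg_in alpha G + deg_in alpha u)%N in
  let d_beta := (deg_in beta G + deg_in beta u)%N in
  alpha != beta ->
  (k < n)%N ->
  full_col_rank G ->
  full_col_rank (slice_mx alpha beta G 0) ->
  largest_block alpha beta G e ->
  (e < deg_in alpha G)%N ->
  v = G *m u ->
  received alpha beta d_alpha d_beta v vhat ->
  (forall r, (r < l)%N -> (jj r < jj r.+1)%N) ->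
  jj l = d_alpha ->
  (jj 0%N <= e)%N ->
  (forall r, (r < l)%N -> (jj r.+1 - (jj r).+1 <= e)%N) ->
  decodable d_beta (gen_block alpha beta G (jj 0%N)) (vhat (jj 0%N)) ->
  (forall r, (r < l)%N ->
     decodable d_beta (gen_block alpha beta G (jj r.+1 - (jj r).+1))
       (vhat (jj r.+1))) ->
  forall res, alg2 alpha beta G e d_alpha d_beta vhat [::] res
    <-> res = Some (u, v).
Proof.
move=> da db ab _ _ _ [adm _] _ -> recv jj_lt jj_l jj0_e gap_e dec0 decS.
pose us s := mkseq (slice_mx alpha beta u) s.
pose works := block_works alpha beta G e da db vhat.
(* With [da + 1] slices known, any positive [x] points past slice [da]; with fewer,
   [exists_block_works] supplies a block. *)
have stuckP s : (s <= da.+1)%N -> (forall x, ~ works s x) <-> s = da.+1.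
  move=> le_s; split=> [stuck | -> x [/andP[x_gt0 _] le_da _]]; last first.
    by move: le_da; rewrite -(prednK x_gt0) addnS /= addSn ltnNge leq_addr.
  apply/eqP; rewrite eqn_leq le_s ltnNge; apply/negP => le_sda.
  have [x] := exists_block_works adm jj_lt jj_l jj0_e gap_e dec0 decS le_sda.
  exact: stuck.
have pred_le x : (x <= e.+1)%N -> (x.-1 <= e)%N by case: x.
have us_end : unslice alpha beta (us da.+1) = u.
  apply: unslice_slices => // i lt_i; apply: slice_mx_gt_deg => //.
  by apply: leq_ltn_trans lt_i; exact: leq_addl.
have works_le s x : works s x -> (0 < x <= e.+1)%N /\ (s + x <= da.+1)%N.
  case=> /[dup] x_bnd _ le_da _; split=> //.
  by case: (s + x)%N le_da.
(* Invariant of a run: the known list is an initial segment of the true slices of [u]. *)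
have run_sound us0 r : alg2 alpha beta G e da db vhat us0 r ->
    forall s, (s <= da.+1)%N -> us0 = us s -> r = Some (u, G *m u).
  elim=> {us0 r} [us0 x w bl r + + run1 size_bl def_w _ IH s le_s def_us
    | us0 + + s le_s def_us | us0 + + s le_s def_us];
    rewrite def_us size_mkseq.
  - move=> works_x _; have [/andP[x_gt0 x_le] le_sx] := works_le _ _ works_x.
    apply: (IH (s + x)%N) => //; rewrite def_us -[in RHS](prednK x_gt0).
    have [_ full_x] := admissible_gen_block (y := x.-1) adm (pred_le _ x_le).
    apply: (slices_of_block full_x); rewrite ?prednK // def_w.
    rewrite def_us size_mkseq in run1.
    exact: (alg1_residual_word w ab adm recv works_x).1 run1.
  - by move=> _ ->; rewrite us_end.
  by move=> /(stuckP _ le_s).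
move=> res; split=> [run | ->]; first exact: (run_sound _ _ run 0%N).
have stop s : (s <= da.+1)%N -> (forall x, ~ works s x) ->
    alg2 alpha beta G e da db vhat (us s) (Some (u, G *m u)).
  move=> le_s stuck; have s_end := (stuckP s le_s).1 stuck.
  rewrite -{1 2}us_end -s_end.
  by apply: Alg2Success; rewrite size_mkseq.
(* A run is built by induction on the number of slices still unknown, which drops at each stage
   since [x] is positive. *)
suff run_us d s : (da.+1 - s <= d)%N -> (s <= da.+1)%N ->
    alg2 alpha beta G e da db vhat (us s) (Some (u, G *m u)).
  exact: (run_us _ 0%N (leqnn _)).
elim: d s => [|d IHd] s le_d le_s.
  by apply/stop/stuckP => //; apply/eqP; rewrite eqn_leq le_s -subn_eq0 -leqn0.
have [ex_x | no_x] := classic (exists x, works s x); last first.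
  by apply: stop => // x works_x; apply: no_x; exists x.
(* The values are tried downwards, so the stage must take the largest that works. *)
have [x works_x max_x] := exists_largest
  (fun x works_x => proj2 (andP (works_le s x works_x).1)) ex_x.
have [/andP[x_gt0 x_le] le_sx] := works_le _ _ works_x.
have [_ full_x] := admissible_gen_block (y := x.-1) adm (pred_le _ x_le).
(* The recovered block is made of the true slices [u_s, ..., u_(s+x-1)]. *)
pose bl := mkseq (fun j => slice_mx alpha beta u (s + j)) x.
have bl_nth : \mxcol_(j < x.-1.+1) bl`_j
    = \mxcol_(j < x.-1.+1) slice_mx alpha beta u (s + j).
  by apply/eq_mxcolP => j; rewrite nth_mkseq ?(leq_trans (ltn_ord j)) ?prednK.
have us_bl : us s ++ bl = us (s + x)%N.
  rewrite -[in RHS](prednK x_gt0); apply: (slices_of_block full_x).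
    by rewrite size_mkseq prednK.
  by rewrite bl_nth.
apply: (Alg2Step (x := x) (bl := bl)
  (w := gen_block alpha beta G x.-1 *m \mxcol_(j < x.-1.+1) bl`_j)) => //.
- by rewrite size_mkseq.
- by rewrite size_mkseq.
- rewrite size_mkseq; apply/(alg1_residual_word _ ab adm recv works_x).
  by rewrite bl_nth.
- by rewrite size_mkseq.
rewrite us_bl; apply: IHd => //.
by rewrite -ltnS (leq_trans _ le_d) // ltn_sub2l // -[s.+1]addn1 ?leq_add2l //
  (leq_trans _ le_sx) // leq_add2l.
Qed.
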